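(* Let a cyclic quadrilateral $\mathcal Q$ be circumscribed about a central conic. Suppose that the circumcenter of $\mathcal Q$ coincides with the center of the conic. Then the circumcircle of $\mathcal Q$ either passes through the foci of the conic or is the orthoptic of the conic.
   Context: A central conic is an ellipse or a hyperbola, given in suitable coordinates by $\frac{x^2}{a^2}+\varepsilon\frac{y^2}{b^2}=1$ with $\varepsilon=1$ (ellipse) or $\varepsilon=-1$ (hyperbola). A quadrilateral with vertices $z_1,z_2,z_3,z_4$ (in this order) is circumscribed about a conic if the four side lines $z_1z_2,z_2z_3,z_3z_4,z_4z_1$ are tangent to the conic; the quadrilateral need not be convex. The orthoptic of a curve is the locus of points at which a pair of tangents to the curve meet at a right angle; the orthoptic of the central conic $\frac{x^2}{a^2}+\varepsilon\frac{y^2}{b^2}=1$, if it exists, is the circle $x^2+y^2=a^2+\varepsilon b^2$. *)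

(* Defs.v *)
From mathcomp Require Import all_boot all_order all_algebra.
From mathcomp Require Import boolp classical_sets reals.

Set Implicit Arguments.
Unset Strict Implicit.
Unset Printing Implicit Defensive.

Import Order.TTheory GRing.Theory Num.Theory.

Local Open Scope classical_set_scope.
Local Open Scope ring_scope.

Section Plane.
Variable R : realType.
Implicit Types p q u v o : R * R.

Definition dot u v : R := u.1 * v.1 + u.2 * v.2.

Definition det u v : R := u.1 * v.2 - u.2 * v.1.

(* A line only if [p != q]; every use below carries that side condition. *)
Definition line p q : set (R * R) := [set x | det (q - p) (x - p) = 0].

Definition circle o (r : R) : set (R * R) :=
  [set x | dot (x - o) (x - o) = r ^+ 2].

End Plane.

Inductive conic_kind := Ellipse | Hyperbola.

(* A central conic in arbitrary position: the coordinates in which it has the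
   equation x^2/a^2 + eps * y^2/b^2 = 1 have origin [center], first axis
   directed by the unit vector [axis], and second axis directed by [axis]
   rotated by a right angle.  Neither [a >= b] nor [a != b] is required, so an
   ellipse may have its major axis along y, and circles are included. *)
Record central_conic (R : realType) := CentralConic {
  kind : conic_kind;
  center : R * R;
  axis : R * R;
  semi_a : R;
  semi_b : R;
  axis_unit : dot axis axis = 1;
  semi_a_gt0 : 0 < semi_a;
  semi_b_gt0 : 0 < semi_b }.

Section Conic.
Variables (R : realType) (K : central_conic R).
Implicit Types p q s : R * R.

Let a := semi_a K.
Let b := semi_b K.

Definition eps : R := if kind K is Ellipse then 1 else -1.

Definition xcoord p : R := dot (axis K) (p - center K).
Definition ycoord p : R := det (axis K) (p - center K).

Definition conic : set (R * R) :=
  [set p | xcoord p ^+ 2 / a ^+ 2 + eps * (ycoord p ^+ 2 / b ^+ 2) = 1].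

(* The line through [s] orthogonal to the gradient of the equation at [s]. *)
Definition tangent_at s : set (R * R) :=
  [set p | xcoord s / a ^+ 2 * (xcoord p - xcoord s)
           + eps * (ycoord s / b ^+ 2 * (ycoord p - ycoord s)) = 0].

Definition asymptote (L : set (R * R)) : Prop :=
  kind K = Hyperbola /\
  (L = [set p | xcoord p / a = ycoord p / b] \/
   L = [set p | xcoord p / a = - (ycoord p / b)]).

(* The asymptotes of a hyperbola count as tangents, with point of contact at
   infinity.  Without them the orthoptic of a hyperbola would not be a full
   circle: the four points of x^2 + y^2 = a^2 - b^2 on the asymptotes, where
   one of the two perpendicular tangents is an asymptote, would be missing. *)
Definition tangent (L : set (R * R)) : Prop :=
  (exists2 s, conic s & L = tangent_at s) \/ asymptote L.

Definition orthoptic : set (R * R) :=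
  [set p | exists q1 q2, [/\ q1 != p, q2 != p, dot (q1 - p) (q2 - p) = 0,
                             tangent (line p q1) & tangent (line p q2)]].

(* The foci lie on the x-axis if a^2 - eps * b^2 >= 0 (always the case for a
   hyperbola), and on the y-axis for an ellipse with a < b; those of a circle
   are both the center. *)
Definition foci : set (R * R) :=
  let c2 := a ^+ 2 - eps * b ^+ 2 in
  [set p | if 0 <= c2 then `|xcoord p| = Num.sqrt c2 /\ ycoord p = 0
           else xcoord p = 0 /\ `|ycoord p| = Num.sqrt (- c2)].

(* Meaningful for pairwise distinct vertices only. *)
Definition circumscribed z1 z2 z3 z4 : Prop :=
  [/\ tangent (line z1 z2), tangent (line z2 z3),
      tangent (line z3 z4) & tangent (line z4 z1)].

End Conic.

Definition inscribed (R : realType) (z1 z2 z3 z4 : R * R) (C : set (R * R)) :=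
  [/\ C z1, C z2, C z3 & C z4].

(* Main.v *)
(* In the coordinates of the conic x^2 / A + y^2 / B = 1, with A = a^2 and
   B = eps b^2, a chord of the circle x^2 + y^2 = r^2 with ends (x1, y1) and
   (x2, y2) is tangent to the conic iff
     (A - B - r^2) x1 x2 - (A - B + r^2) y1 y2 = r^2 (r^2 - A - B).
   If A - B is r^2 or - r^2, the foci lie on the circle.  Otherwise, subtracting
   the relations for the two sides at z2, and likewise at z4, shows that z2 and
   z4 are orthogonal to the same nonzero vector, so z4 = - z2.  The relations
   for z1 z2 and z1 z4 then give r^2 = A + B, the radius of the orthoptic. *)
Require Import Defs.
From mathcomp Require Import all_boot all_order all_algebra.
From mathcomp Require Import boolp classical_sets reals.
From mathcomp Require Import ring.

Import Order.TTheory GRing.Theory Num.Theory.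

Local Open Scope classical_set_scope.
Local Open Scope ring_scope.

Lemma subr_eq0P (R : zmodType) (x y : R) : x - y = 0 -> x = y.
Proof. by move/eqP; rewrite subr_eq0 => /eqP. Qed.

(** * Orthonormal coordinates attached to the conic *)

Section Coordinates.
Variables (R : realType) (K : central_conic R).
Implicit Types p q x : R * R.

Local Notation X := (xcoord K).
Local Notation Y := (ycoord K).
Local Notation A := (semi_a K ^+ 2).
Local Notation B := (eps K * semi_b K ^+ 2).

(** The frame is orthonormal, so the change of coordinates is a direct isometry. Writing a factor 1
    as the squared norm of [axis K] leaves a polynomial identity. *)
Lemma det_coord p q x :
  det (q - p) (x - p) = (X q - X p) * (Y x - Y p) - (Y q - Y p) * (X x - X p).
Proof.
have := axis_unit K; rewrite /xcoord /ycoord /dot /det /= => h.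
by rewrite -[LHS]mul1r -h; ring.
Qed.

Lemma dot_coord p q x :
  dot (q - p) (x - p) = (X q - X p) * (X x - X p) + (Y q - Y p) * (Y x - Y p).
Proof.
have := axis_unit K; rewrite /xcoord /ycoord /dot /det /= => h.
by rewrite -[LHS]mul1r -h; ring.
Qed.

Lemma xcoord_center : X (center K) = 0.
Proof. by rewrite /xcoord /dot /=; ring. Qed.

Lemma ycoord_center : Y (center K) = 0.
Proof. by rewrite /ycoord /det /=; ring. Qed.

Lemma circle_coord r p : circle (center K) r p <-> X p ^+ 2 + Y p ^+ 2 = r ^+ 2.
Proof.
by rewrite /circle /= dot_coord xcoord_center ycoord_center !subr0 -!expr2.
Qed.

Lemma coordK p : p = center K + (X p * (axis K).1 - Y p * (axis K).2,
                                 X p * (axis K).2 + Y p * (axis K).1).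
Proof.
have := axis_unit K; rewrite /xcoord /ycoord /dot /det /= => h.
rewrite [LHS]surjective_pairing; congr pair => /=.
  by rewrite -[LHS](subrK (center K).1) -[p.1 - _]mul1r -{1}h; ring.
by rewrite -[LHS](subrK (center K).2) -[p.2 - _]mul1r -{1}h; ring.
Qed.

Lemma coord_inj p q : X p = X q -> Y p = Y q -> p = q.
Proof. by move=> hX hY; rewrite (coordK p) (coordK q) hX hY. Qed.

Lemma coord_ex u v : exists p, X p = u /\ Y p = v.
Proof.
have := axis_unit K; rewrite /dot => h.
exists (center K + (u * (axis K).1 - v * (axis K).2,
                    u * (axis K).2 + v * (axis K).1)).
rewrite /xcoord /ycoord /dot /det /=; split.
  by rewrite -[RHS]mul1r -h; ring.
by rewrite -[RHS]mul1r -h; ring.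
Qed.

Lemma line_coord p q x : line p q x <->
  (Y q - Y p) * X x - (X q - X p) * Y x = X p * Y q - X q * Y p.
Proof.
rewrite /line /= det_coord; split=> h.
  by apply: subr_eq0P; rewrite -[RHS]oppr0 -h; ring.
by move/eqP: h; rewrite -subr_eq0 -oppr_eq0 => /eqP <-; ring.
Qed.

(** * Tangency as the equation of the dual conic *)

Lemma eps_sqr : eps K ^+ 2 = 1.
Proof. by rewrite /eps; case: (kind K); rewrite ?sqrrN expr1n. Qed.

Let a0 : semi_a K != 0. Proof. by rewrite gt_eqF ?semi_a_gt0. Qed.
Let b0 : semi_b K != 0. Proof. by rewrite gt_eqF ?semi_b_gt0. Qed.

(** The coefficients of the line satisfy the equation of the dual conic. For an asymptote both sides
    vanish. *)
Lemma tangent_line_eq p q : tangent K (line p q) ->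
  A * (Y q - Y p) ^+ 2 + B * (X q - X p) ^+ 2 = (X p * Y q - X q * Y p) ^+ 2.
Proof.
have Lp : line p q p by apply/line_coord; ring.
have Lq : line p q q by apply/line_coord; ring.
case=> [[s]|[kH]].
  rewrite /conic /= => hs hL; move: Lp Lq; rewrite hL /tangent_at /=.
  set x := X s in hs *; set y := Y s in hs *.
  (* The tangent at [s] reads [l * X + m * Y = 1]; [elm] puts [(l, m)] on the dual conic. *)
  pose l := x / A; pose m := eps K * (y / semi_b K ^+ 2) => hp hq.
  have elm : A * l ^+ 2 + B * m ^+ 2 = 1.
    rewrite -hs /l /m; have := eps_sqr.
    move: (eps K) => e e2.
    have -> : e * semi_b K ^+ 2 * (e * (y / semi_b K ^+ 2)) ^+ 2
      = e * e ^+ 2 * (y ^+ 2 / semi_b K ^+ 2) by field; rewrite ?a0 ?b0.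
    by rewrite e2; field; rewrite ?a0 ?b0.
  have ep : l * X p + m * Y p = 1.
    apply: subr_eq0P; rewrite -{1}hs -[RHS]hp /l /m; field.
    by rewrite a0 b0.
  have eq : l * X q + m * Y q = 1.
    apply: subr_eq0P; rewrite -{1}hs -[RHS]hq /l /m; field.
    by rewrite a0 b0.
  (* Cramer's rule: each factor 1 is replaced by the equation at the other point. *)
  have eY : Y q - Y p = l * (X p * Y q - X q * Y p).
    rewrite -[Y q in LHS]mulr1 -[Y p in LHS]mulr1.
    by rewrite -[in Y q * 1]ep -[in Y p * 1]eq; ring.
  have eX : X q - X p = - m * (X p * Y q - X q * Y p).
    rewrite -[X q in LHS]mulr1 -[X p in LHS]mulr1.
    by rewrite -[in X q * 1]ep -[in X p * 1]eq; ring.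
  by rewrite eX eY -[RHS]mul1r -elm; ring.
move=> hL.
(* The sign [t] treats both asymptotes at once. *)
have [t t2 [hp hq]] : exists2 t : R, t ^+ 2 = 1 &
    X p / semi_a K = t * (Y p / semi_b K) /\
    X q / semi_a K = t * (Y q / semi_b K).
  case: hL => hL; move: Lp Lq; rewrite hL /= => hp hq.
    by exists 1; rewrite ?expr1n ?mul1r.
  by exists (-1); rewrite ?sqrrN ?expr1n ?mulN1r.
have eX z : X z / semi_a K = t * (Y z / semi_b K) ->
    X z = t * (semi_a K / semi_b K * Y z).
  by move/(canRL (divfK a0)) ->; ring.
rewrite (eX p hp) (eX q hq) /eps kH.
transitivity (A * (Y q - Y p) ^+ 2 * (1 - t ^+ 2)); first by field.
by rewrite t2; ring.
Qed.

(** A line missing the center touches the conic at its pole; one through the center is an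
    asymptote. *)
Lemma tangent_line p q : p != q ->
  A * (Y q - Y p) ^+ 2 + B * (X q - X p) ^+ 2 = (X p * Y q - X q * Y p) ^+ 2 ->
  tangent K (line p q).
Proof.
move=> npq; set n := X p * Y q - X q * Y p.
set dy := Y q - Y p; set dx := X q - X p => h.
have [n0|n0] := eqVneq n 0.
  have [hY|hY] := eqVneq dy 0.
    move: h; rewrite n0 hY !expr0n /= mulr0 add0r => /eqP.
    rewrite mulf_eq0 sqrf_eq0 => /orP[|/eqP hX].
      rewrite mulf_eq0 sqrf_eq0 (negbTE b0) orbF => /eqP e0.
      by have := eps_sqr; rewrite e0 expr0n => /esym/eqP; rewrite oner_eq0.
    by case/eqP: npq; apply: coord_inj; apply/esym/subr_eq0P.
  have A0 : 0 < A by rewrite exprn_gt0 ?semi_a_gt0.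
  have Y2 : 0 < dy ^+ 2 by rewrite exprn_even_gt0.
  (* For an ellipse the left side of [h] would be positive, as [dy] is nonzero. *)
  have kH : kind K = Hyperbola.
    move: h; rewrite n0 expr0n /= /eps; case: (kind K) => // h.
    have := mulr_gt0 A0 Y2.
    have : 0 <= 1 * semi_b K ^+ 2 * dx ^+ 2 by rewrite mul1r mulr_ge0 ?sqr_ge0.
    by move=> h1 h2; have := ltr_wpDr h1 h2; rewrite h ltxx.
  have lineE (t : R) : semi_a K * dy = t * (semi_b K * dx) -> t ^+ 2 = 1 ->
      line p q = [set z | X z / semi_a K = t * (Y z / semi_b K)].
    move=> hd t2.
    have edx : dx = t * (semi_a K * dy / semi_b K).
      rewrite hd -[LHS]mul1r -t2; by field.
    have e z : dy * X z - dx * Y z =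
        dy * semi_a K * (X z / semi_a K - t * (Y z / semi_b K)).
      by rewrite edx; field; rewrite a0 b0.
    apply/funext => z; apply/propext; apply: (iff_trans (line_coord _ _ _)).
    rewrite -/dy -/dx -/n n0 e /=; split=> [/eqP|->].
      by rewrite !mulf_eq0 (negbTE hY) (negbTE a0) /= subr_eq0 => /eqP.
    by rewrite subrr mulr0.
  have : (semi_a K * dy) ^+ 2 == (semi_b K * dx) ^+ 2.
    by rewrite -subr_eq0 -[X in _ == X](expr0n _ 2) -n0 -h /eps kH; apply/eqP; ring.
  rewrite eqf_sqr => /orP[]/eqP hd; right; split=> //; [left|right].
    by rewrite (lineE 1) ?expr1n ?mul1r//; apply/funext => z /=; rewrite mul1r.
  rewrite (lineE (-1)) ?sqrrN ?expr1n ?mulN1r//.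
  by apply/funext => z /=; rewrite mulN1r.
(* The pole of the line [dy * X - dx * Y = n]. *)
have [s [sX sY]] := coord_ex (A * dy / n) (- (B * dx / n)).
left; exists s.
  rewrite /conic /= sX sY -[RHS](divff (expf_neq0 2 n0)) -{1}h.
  (* The square of [eps K] is kept explicit, since [field] treats [eps K] as an indeterminate. *)
  transitivity ((A * dy ^+ 2 + eps K ^+ 2 * B * dx ^+ 2) / n ^+ 2).
    by field; rewrite n0 a0 b0.
  by rewrite eps_sqr mul1r.
have e z : A * dy / n / A * (X z - A * dy / n) +
    eps K * (- (B * dx / n) / semi_b K ^+ 2 * (Y z - - (B * dx / n))) =
    (dy * X z - dx * Y z - n) / n.
  transitivity ((dy * X z - eps K ^+ 2 * (dx * Y z)
                - (A * dy ^+ 2 + eps K ^+ 2 * B * dx ^+ 2) / n) / n).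
    by field; rewrite n0 a0 b0.
  by rewrite eps_sqr !mul1r h; field.
apply/seteqP; split=> z; rewrite line_coord /tangent_at /= sX sY e -/dy -/dx -/n.
  by move=> ->; rewrite subrr mul0r.
by move/eqP; rewrite mulf_eq0 invr_eq0 (negbTE n0) orbF subr_eq0 => /eqP.
Qed.

(** * The orthoptic circle *)

(* The directions of the tangents through a point form the isotropic cone of a
   quadratic form with trace A + B - |p|^2. *)
Lemma orthoptic_circle r : r ^+ 2 = A + B ->
  circle (center K) r = orthoptic K.
Proof.
move=> hr; apply/seteqP; split=> p.
  move/circle_coord; rewrite hr => hp.
  (* On the circle the form has trace zero, hence matrix entries [P], [S], [- P]. *)
  pose P := X p ^+ 2 - A; pose S := X p * Y p.
  have PE : B - Y p ^+ 2 = P.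
    by apply: subr_eq0P; rewrite /P -[RHS](subrr (A + B)) -{2}hp; ring.
  have [u [v [huv uv0]]] : exists u v,
      P * u ^+ 2 + 2 * S * u * v - P * v ^+ 2 = 0 /\ (u != 0) || (v != 0).
    have [P0|P0] := eqVneq P 0.
      by exists 1, 0; rewrite P0 oner_eq0; split=> //; ring.
    (* With [v = P] the equation becomes [P * ((u + S) ^+ 2 - S ^+ 2 - P ^+ 2) = 0]. *)
    exists (Num.sqrt (S ^+ 2 + P ^+ 2) - S), P; rewrite P0 orbT; split=> //.
    have := @sqr_sqrtr R (S ^+ 2 + P ^+ 2).
    rewrite addr_ge0 ?sqr_ge0// => /(_ isT); set t := Num.sqrt _ => t2.
    transitivity (P * (t ^+ 2 - (S ^+ 2 + P ^+ 2))); first by ring.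
    by rewrite t2 subrr mulr0.
  have [q1 [q1X q1Y]] := coord_ex (X p + u) (Y p + v).
  (* A quarter turn changes the sign of a form of trace zero, so it preserves isotropy. *)
  have [q2 [q2X q2Y]] := coord_ex (X p - v) (Y p + u).
  have n1 : q1 != p.
    apply/eqP => e; move: uv0; rewrite e in q1X q1Y.
    have -> : u = 0 by apply: (addrI (X p)); rewrite addr0.
    have -> : v = 0 by apply: (addrI (Y p)); rewrite addr0.
    by rewrite eqxx.
  have n2 : q2 != p.
    apply/eqP => e; move: uv0; rewrite e in q2X q2Y.
    have -> : u = 0 by apply: (addrI (Y p)); rewrite addr0.
    have -> : v = 0 by apply: oppr_inj; apply: (addrI (X p)); rewrite oppr0 addr0.
    by rewrite eqxx.
  exists q1, q2; split=> //.
  - by rewrite dot_coord q1X q1Y q2X q2Y; ring.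
  - apply: tangent_line; first by rewrite eq_sym.
    rewrite q1X q1Y; apply: subr_eq0P.
    by rewrite -[RHS]huv -{1}PE /P /S; ring.
  - apply: tangent_line; first by rewrite eq_sym.
    rewrite q2X q2Y; apply: subr_eq0P.
    by rewrite -[RHS]oppr0 -huv -{2}PE /P /S; ring.
case=> q1 [q2 [n1 n2]]; rewrite dot_coord => ho.
move=> /tangent_line_eq h1 /tangent_line_eq h2.
apply/circle_coord; rewrite hr; move: h1 h2.
set u1 := X q1 - X p in ho *; set v1 := Y q1 - Y p in ho *.
set u2 := X q2 - X p in ho *; set v2 := Y q2 - Y p in ho *.
have -> : X p * Y q1 - X q1 * Y p = X p * v1 - Y p * u1 by rewrite /u1 /v1; ring.
have -> : X p * Y q2 - X q2 * Y p = X p * v2 - Y p * u2 by rewrite /u2 /v2; ring.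
have norm_neq0 q : q != p -> (X q - X p) ^+ 2 + (Y q - Y p) ^+ 2 != 0.
  apply: contra; rewrite paddr_eq0 ?sqr_ge0// !sqrf_eq0 !subr_eq0.
  by case/andP=> /eqP hX /eqP hY; apply/eqP/coord_inj.
move: (norm_neq0 _ n1) (norm_neq0 _ n2); rewrite -/u1 -/v1 -/u2 -/v2.
set N1 := _ + _; set N2 := _ + _ => N10 N20 h1 h2.
have [k [ku kv]] : exists k, u2 = - (k * v1) /\ v2 = k * u1.
  exists ((u1 * v2 - v1 * u2) / N1).
  split; apply: (mulIf N10).
    rewrite mulNr mulrAC divfK // /N1; apply: subr_eq0P.
    by transitivity (u1 * (u1 * u2 + v1 * v2)); [ring|rewrite ho mulr0].
  rewrite mulrAC divfK // /N1; apply: subr_eq0P.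
  by transitivity (v1 * (u1 * u2 + v1 * v2)); [ring|rewrite ho mulr0].
have k0 : k != 0.
  by apply: contra_neq N20 => k0; rewrite /N2 ku kv k0 !mul0r oppr0 !expr0n addr0.
apply: (mulIf N10); apply: (mulfI (expf_neq0 2 k0)); apply/esym.
(* Adding the form over two orthogonal vectors, scaled to equal length, gives its trace. *)
transitivity (k ^+ 2 * (A * v1 ^+ 2 + B * u1 ^+ 2) +
              (A * v2 ^+ 2 + B * u2 ^+ 2)).
  by rewrite ku kv /N1; ring.
by rewrite h1 h2 ku kv /N1; ring.
Qed.

(** * Chords of a concentric circle *)

(* The tangency condition of [tangent_line_eq], multiplied by r^2, is the stated
   relation multiplied by r^2 - p.q, which vanishes only for p = q. *)
Lemma chord_tangent r p q : p != q ->
  X p ^+ 2 + Y p ^+ 2 = r ^+ 2 -> X q ^+ 2 + Y q ^+ 2 = r ^+ 2 ->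
  tangent K (line p q) ->
  (A - B - r ^+ 2) * (X p * X q) - (A - B + r ^+ 2) * (Y p * Y q) =
    r ^+ 2 * (r ^+ 2 - (A + B)).
Proof.
move=> npq hp hq /tangent_line_eq h.
have npq2 : r ^+ 2 - (X p * X q + Y p * Y q) != 0.
  apply: contra npq => /eqP e.
  have : (X p - X q) ^+ 2 + (Y p - Y q) ^+ 2 == 0.
    apply/eqP; transitivity (X p ^+ 2 + Y p ^+ 2 + (X q ^+ 2 + Y q ^+ 2)
                             - 2 * (X p * X q + Y p * Y q)); first by ring.
    by rewrite hp hq -[RHS](mulr0 2) -e; ring.
  rewrite paddr_eq0 ?sqr_ge0// !sqrf_eq0 !subr_eq0.
  by case/andP=> /eqP hX /eqP hY; apply/eqP/coord_inj.
apply: subr_eq0P; apply: (mulfI npq2); rewrite mulr0.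
(* This exhibits the factor [r ^+ 2 - p.q] in each squared difference; [e2] uses it with the
   coordinates exchanged. *)
have XE (s t x y : R) : x ^+ 2 + y ^+ 2 = r ^+ 2 -> s ^+ 2 + t ^+ 2 = r ^+ 2 ->
    r ^+ 2 * (t - y) ^+ 2 =
    (r ^+ 2 - (x * s + y * t)) * (r ^+ 2 + (x * s - y * t)).
  move=> exy est; apply: subr_eq0P.
  transitivity (x ^+ 2 * s ^+ 2 - (r ^+ 2 - y ^+ 2) * (r ^+ 2 - t ^+ 2)).
    by ring.
  by rewrite -{1}exy -est; ring.
have e1 := XE (X q) (Y q) (X p) (Y p) hp hq.
have e2 : r ^+ 2 * (X q - X p) ^+ 2 = (r ^+ 2 - (Y p * Y q + X p * X q))
    * (r ^+ 2 + (Y p * Y q - X p * X q)).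
  by apply: XE; rewrite addrC.
(* Lagrange's identity, where [r ^+ 2 - p.q] is again a factor. *)
have e3 : (X p * Y q - X q * Y p) ^+ 2 =
    r ^+ 2 * r ^+ 2 - (X p * X q + Y p * Y q) ^+ 2.
  by rewrite -{1}hp -hq; ring.
transitivity (A * (r ^+ 2 * (Y q - Y p) ^+ 2) + B * (r ^+ 2 * (X q - X p) ^+ 2)
              - r ^+ 2 * (X p * Y q - X q * Y p) ^+ 2).
  by rewrite e1 e2 e3; ring.
by rewrite -h; ring.
Qed.

(** [A - B] is the signed squared focal distance; its sign selects the axis carrying the foci. *)
Lemma foci_circle r : 0 < r -> A - B = r ^+ 2 \/ A - B = - r ^+ 2 ->
  foci K `<=` circle (center K) r.
Proof.
move=> r0 hc p; rewrite /foci /= => hp; apply/circle_coord; move: hp.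
have r2 : 0 < r ^+ 2 by rewrite exprn_gt0.
case: hc => ->.
  rewrite (ltW r2) => -[hX ->].
  by rewrite -(real_normK (num_real (X p))) hX sqr_sqrtr ?(ltW r2)// expr0n addr0.
rewrite oppr_ge0 leNgt r2 /= opprK => -[-> hY].
by rewrite -(real_normK (num_real (Y p))) hY sqr_sqrtr ?(ltW r2)// expr0n add0r.
Qed.

End Coordinates.

(** * The quadrilateral *)

(** Lagrange's identity forces the dot product [c] to be [r ^+ 2] or its opposite, and [(s, t)] is
    [(x, y)] scaled by [c / r ^+ 2]. *)
Lemma parallel_on_circle (R : realType) (r x y s t : R) :
  x ^+ 2 + y ^+ 2 = r ^+ 2 -> s ^+ 2 + t ^+ 2 = r ^+ 2 -> 0 < r ->
  x * t - s * y = 0 -> (s, t) = (x, y) \/ (s, t) = (- x, - y).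
Proof.
move=> hx hs r0 hd.
have r2 : r ^+ 2 != 0 by rewrite expf_neq0 ?gt_eqF.
set c := x * s + y * t.
have cs : r ^+ 2 * s = c * x.
  apply: subr_eq0P; rewrite -hx /c.
  by transitivity (- y * (x * t - s * y)); [ring|rewrite hd mulr0].
have ct : r ^+ 2 * t = c * y.
  apply: subr_eq0P; rewrite -hx /c.
  by transitivity (x * (x * t - s * y)); [ring|rewrite hd mulr0].
have : c ^+ 2 == (r ^+ 2) ^+ 2.
  rewrite -subr_eq0 [X in _ - X]expr2 -{1}hx -hs.
  apply/eqP; transitivity (- (x * t - s * y) ^+ 2); first by rewrite /c; ring.
  by rewrite hd expr0n oppr0.
rewrite eqf_sqr => /orP[]/eqP hc; [left|right]; congr pair; apply: (mulfI r2);
  by rewrite ?cs ?ct hc ?mulrN ?mulNr.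
Qed.

Theorem theorem4p4 (R : realType) (K : central_conic R)
    (z1 z2 z3 z4 : R * R) (o : R * R) (r : R) :
  uniq [:: z1; z2; z3; z4] ->
  0 < r ->
  inscribed z1 z2 z3 z4 (circle o r) ->
  circumscribed K z1 z2 z3 z4 ->
  o = center K ->
  foci K `<=` circle o r \/ circle o r = orthoptic K.
Proof.
rewrite /= !inE !negb_or => /and4P[/and3P[n12 n13 n14] /andP[n23 n24] n34 _] r0.
move=> + + eo; rewrite {}eo => -[].
move=> /circle_coord c1 /circle_coord c2 /circle_coord c3 /circle_coord c4.
case=> /(chord_tangent _ _ _ _ _ n12 c1 c2) e12 /(chord_tangent _ _ _ _ _ n23 c2 c3) e23.
rewrite eq_sym in n14.
move=> /(chord_tangent _ _ _ _ _ n34 c3 c4) e34 /(chord_tangent _ _ _ _ _ n14 c4 c1) e41.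
set A := semi_a K ^+ 2 in e12 e23 e34 e41.
set B := eps K * semi_b K ^+ 2 in e12 e23 e34 e41.
set alpha := A - B - r ^+ 2 in e12 e23 e34 e41.
set beta := A - B + r ^+ 2 in e12 e23 e34 e41.
have [/subr_eq0P h|alpha0] := eqVneq alpha 0.
  by left; apply: foci_circle => //; left.
have [h|beta0] := eqVneq beta 0.
  by left; apply: foci_circle => //; right; apply/eqP; rewrite -addr_eq0; apply/eqP.
right; apply: orthoptic_circle => //; apply: subr_eq0P.
have r2 : r ^+ 2 != 0 by rewrite expf_neq0 ?gt_eqF.
apply: (mulfI r2); rewrite mulr0.
set x1 := xcoord K z1 in c1 e12 e41; set y1 := ycoord K z1 in c1 e12 e41.
set x2 := xcoord K z2 in c2 e12 e23; set y2 := ycoord K z2 in c2 e12 e23.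
set x3 := xcoord K z3 in c3 e23 e34; set y3 := ycoord K z3 in c3 e23 e34.
set x4 := xcoord K z4 in c4 e34 e41; set y4 := ycoord K z4 in c4 e34 e41.
set gamma := r ^+ 2 * _ in e12 e23 e34 e41.
have f2 : alpha * (x1 - x3) * x2 - beta * (y1 - y3) * y2 = 0.
  by rewrite -(subrr gamma) -{1}e12 -e23; ring.
have f4 : alpha * (x1 - x3) * x4 - beta * (y1 - y3) * y4 = 0.
  by rewrite -(subrr gamma) -{1}e41 -e34; ring.
(* Otherwise Cramer's rule on [f2] and [f4] would give [z1 = z3]. *)
have D0 : x2 * y4 - x4 * y2 = 0.
  apply/eqP; apply: contraNT n13 => D0; apply/eqP; apply: (coord_inj _ K).
    apply: subr_eq0P; apply: (mulfI alpha0); apply: (mulIf D0).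
    rewrite mulr0 mul0r -/x1 -/x3.
    transitivity ((alpha * (x1 - x3) * x2 - beta * (y1 - y3) * y2) * y4 -
      (alpha * (x1 - x3) * x4 - beta * (y1 - y3) * y4) * y2); first by ring.
    by rewrite f2 f4 !mul0r subrr.
  apply: subr_eq0P; apply: (mulfI beta0); apply: (mulIf D0).
  rewrite mulr0 mul0r -/y1 -/y3.
  transitivity ((alpha * (x1 - x3) * x2 - beta * (y1 - y3) * y2) * x4 -
    (alpha * (x1 - x3) * x4 - beta * (y1 - y3) * y4) * x2); first by ring.
  by rewrite f2 f4 !mul0r subrr.
case: (parallel_on_circle _ _ _ _ _ _ c2 c4 r0 D0) => -[h h'].
  by case/eqP: n24; apply: (coord_inj _ K).
(* For [z4 = - z2] in these coordinates, the left sides of [e12] and [e41] are opposite, yet both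
   equal [gamma]. *)
have : gamma + gamma = 0.
  by rewrite -{1}e12 -e41 h h'; ring.
by move/eqP; rewrite -mulr2n mulrn_eq0 => /eqP.
Qed.
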